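(* Let $d\geq\ell>0$ be integers. Then $$\prod_{(\lambda,\Box)\in S_{d,\ell}}\frac{1}{1-x^{a_\lambda(\Box)+1}y^{\ell_\lambda(\Box)}}=\prod_{(\lambda',\Box')\in S'_{d-\ell,\ell}}\frac{1}{1-x^{a_{\lambda'}(\Box')+1}y^{\ell_{\lambda'}(\Box')}}.$$
   Context: A partition $\lambda=(\lambda_1\geq\lambda_2\geq\dots)$ is a finite sequence of positive integers (extended by zeros), of size $|\lambda|=\sum_i\lambda_i$. Its Young diagram is the set of boxes $(i,j)\in\mathbb{Z}_{\geq 0}^2$ with $0\leq j<\lambda_{i+1}$. Partitions are identified with their Young diagrams, and $\mathcal{P}_d$ is the set of Young diagrams of size $d$. For $\Box=(i,j)\in\lambda$ the arm and leg lengths are $a_\lambda(\Box)=|\{(i,j')\in\lambda\mid j<j'\}|$ and $\ell_\lambda(\Box)=|\{(i',j)\in\lambda\mid i<i'\}|$. For $\Box=(i,j)\in\mathbb{Z}_{\ge0}^2\setminus\lambda$ they are $a_\lambda(\Box)=|\{(i,j')\notin\lambda\mid 0\le j'<j\}|$ and $\ell_\lambda(\Box)=|\{(i',j)\notin\lambda\mid 0\le i'<i\}|$. The hook length is $h_\lambda(\Box)=a_\lambda(\Box)+\ell_\lambda(\Box)+1$. Internal (resp. external) hooks of $\lambda$ are identified with boxes $\Box\in\lambda$ (resp. $\Box\in\mathbb{Z}_{\geq0}^2\setminus\lambda$). The index $\ell$ (a hook length) is not to be confused with the leg length function $\ell_\lambda(\cdot)$. For integers $d\geq 0$ and $\ell>0$,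 $$S_{d,\ell}=\{(\lambda,\Box)\mid\lambda\in\mathcal{P}_d,\ \Box\in\lambda,\ h_\lambda(\Box)=\ell\},\qquad S'_{d,\ell}=\{(\lambda,\Box)\mid\lambda\in\mathcal{P}_d,\ \Box\in\mathbb{Z}_{\geq0}^2\setminus\lambda,\ h_\lambda(\Box)=\ell\}.$$ The identity holds in $\mathbb{Z}[[x,y]]$, with $x,y$ formal variables. *)

(* Defs.v *)
From HB Require Import structures.
From mathcomp Require Import all_boot all_order all_algebra.
From mathcomp Require Import finmap.
From mathcomp Require Import zify.
From mathcomp Require Import boolp classical_sets cardinality fsbigop.

Set Implicit Arguments.
Unset Strict Implicit.
Unset Printing Implicit Defensive.

Import GRing.Theory.

Local Open Scope ring_scope.

(* R[[x, y]]: [coef2 f m n] is the coefficient of x^m y^n in f. *)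
Record fps2 (R : Type) := Fps2 { coef2 : nat -> nat -> R }.

HB.instance Definition _ (R : Type) := gen_eqMixin (fps2 R).
HB.instance Definition _ (R : Type) := gen_choiceMixin (fps2 R).

Lemma fps2P (R : Type) (f g : fps2 R) :
  (forall m n, coef2 f m n = coef2 g m n) -> f = g.
Proof.
case: f g => [f] [g] /= fg; congr Fps2.
by apply/funext => m; apply/funext => n.
Qed.

Section Ring.
Variable R : comNzRingType.
Implicit Types f g h : fps2 R.

Definition fps2_zero : fps2 R := Fps2 (fun _ _ => 0).
Definition fps2_one : fps2 R :=
  Fps2 (fun m n => if (m == 0%N) && (n == 0%N) then 1 else 0).
Definition fps2_opp f := Fps2 (fun m n => - coef2 f m n).
Definition fps2_add f g := Fps2 (fun m n => coef2 f m n + coef2 g m n).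
Definition fps2_mul f g := Fps2 (fun m n =>
  \sum_(i < m.+1) \sum_(j < n.+1) coef2 f i j * coef2 g (m - i) (n - j)).

Fact fps2_addA : associative fps2_add.
Proof. by move=> f g h; apply: fps2P => m n /=; rewrite addrA. Qed.
Fact fps2_addC : commutative fps2_add.
Proof. by move=> f g; apply: fps2P => m n /=; rewrite addrC. Qed.
Fact fps2_add0 : left_id fps2_zero fps2_add.
Proof. by move=> f; apply: fps2P => m n /=; rewrite add0r. Qed.
Fact fps2_addN : left_inverse fps2_zero fps2_opp fps2_add.
Proof. by move=> f; apply: fps2P => m n /=; rewrite addNr. Qed.

HB.instance Definition _ := GRing.isZmodule.Build (fps2 R)
  fps2_addA fps2_addC fps2_add0 fps2_addN.

(* The ring axioms are transported from {poly {poly R}} along truncation. *)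
Let pol N f : {poly {poly R}} := \poly_(i < N) \poly_(j < N) coef2 f i j.

Let pol_coef N f m n : (m < N)%N -> (n < N)%N -> (pol N f)`_m`_n = coef2 f m n.
Proof. by move=> mN nN; rewrite coef_poly mN coef_poly nN. Qed.

Let poly2M (P Q : {poly {poly R}}) m n : (P * Q)`_m`_n =
  \sum_(i < m.+1) \sum_(j < n.+1) P`_i`_j * Q`_(m - i)`_(n - j).
Proof. by rewrite coefM coef_sum; apply: eq_bigr => i _; rewrite coefM. Qed.

Let mul_pol N f g (P Q : {poly {poly R}}) m n :
  (m < N)%N -> (n < N)%N ->
  (forall i j, (i < N)%N -> (j < N)%N -> P`_i`_j = coef2 f i j) ->
  (forall i j, (i < N)%N -> (j < N)%N -> Q`_i`_j = coef2 g i j) ->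
  (P * Q)`_m`_n = coef2 (fps2_mul f g) m n.
Proof.
move=> mN nN Pf Qg; rewrite poly2M; apply: eq_bigr => i _; apply: eq_bigr => j _.
have lt_sub a b : (a < N -> a - b < N)%N by apply: leq_ltn_trans; exact: leq_subr.
rewrite Pf ?Qg ?lt_sub //.
  by rewrite (leq_trans (ltn_ord i)).
by rewrite (leq_trans (ltn_ord j)).
Qed.

Let lt_max m n : (m < (maxn m n).+1)%N * (n < (maxn m n).+1)%N.
Proof. by rewrite !ltnS leq_maxl leq_maxr. Qed.

Fact fps2_mulA : associative fps2_mul.
Proof.
move=> f g h; apply: fps2P => m n; set N := (maxn m n).+1.
have [mN nN] := lt_max m n.
rewrite -(@mul_pol N _ _ (pol N f) (pol N g * pol N h)) //.
- rewrite mulrA (@mul_pol N (fps2_mul f g) h) // => i j iN jN.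
    by rewrite (@mul_pol N f g) // => *; exact: pol_coef.
  exact: pol_coef.
- by move=> i j iN jN; exact: pol_coef.
- by move=> i j iN jN; rewrite (@mul_pol N g h) // => *; exact: pol_coef.
Qed.

Fact fps2_mulC : commutative fps2_mul.
Proof.
move=> f g; apply: fps2P => m n; set N := (maxn m n).+1.
have [mN nN] := lt_max m n.
have polM u v : coef2 (fps2_mul u v) m n = (pol N u * pol N v)`_m`_n.
  by rewrite (@mul_pol N u v) // => *; exact: pol_coef.
by rewrite !polM mulrC.
Qed.

Fact fps2_mul1 : left_id fps2_one fps2_mul.
Proof.
move=> f; apply: fps2P => m n /=.
rewrite big_ord_recl big_ord_recl /= mul1r !subn0.
rewrite !big1 ?addr0 // => [i _|i _]; last by rewrite mul0r.
by rewrite big1 // => j _; rewrite mul0r.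
Qed.

Fact fps2_mulD : left_distributive fps2_mul fps2_add.
Proof.
move=> f g h; apply: fps2P => m n /=; rewrite -big_split /=.
apply: eq_bigr => i _; rewrite -big_split /=.
by apply: eq_bigr => j _; rewrite mulrDl.
Qed.

Fact fps2_one_neq0 : fps2_one != 0.
Proof.
apply/eqP => /(congr1 (fun f => coef2 f 0 0)) /= /eqP.
by rewrite oner_eq0.
Qed.

HB.instance Definition _ := GRing.Zmodule_isComNzRing.Build (fps2 R)
  fps2_mulA fps2_mulC fps2_mul1 fps2_mulD fps2_one_neq0.

Definition fps2_unit : {pred fps2 R} := [pred f | `[< exists g, g * f = 1 >]].

(* As usual for unit rings, f^-1 = f when f is not invertible. *)
Definition fps2_inv f : fps2 R :=
  match pselect (exists g, g * f = 1) with
  | left fu => projT1 (cid fu)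
  | right _ => f
  end.

Fact fps2_mulVx : {in fps2_unit, left_inverse 1 fps2_inv *%R}.
Proof.
move=> f /asboolP fu; rewrite /fps2_inv; case: pselect => // fu'.
by case: (cid fu').
Qed.

Fact fps2_unitP f g : g * f = 1 -> fps2_unit f.
Proof. by move=> gf; apply/asboolP; exists g. Qed.

Fact fps2_inv_out : {in [predC fps2_unit], fps2_inv =1 id}.
Proof.
move=> f /negP fu; rewrite /fps2_inv; case: pselect => // fu'.
by case: fu; apply/asboolP.
Qed.

HB.instance Definition _ := GRing.ComNzRing_hasMulInverse.Build (fps2 R)
  fps2_mulVx fps2_unitP fps2_inv_out.

Definition fps2X : fps2 R :=
  Fps2 (fun m n => if (m == 1%N) && (n == 0%N) then 1 else 0).
Definition fps2Y : fps2 R :=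
  Fps2 (fun m n => if (m == 0%N) && (n == 1%N) then 1 else 0).

Lemma coef2M f g m n : coef2 (f * g) m n =
  \sum_(i < m.+1) \sum_(j < n.+1) coef2 f i j * coef2 g (m - i) (n - j).
Proof. by []. Qed.

Lemma coef2D f g m n : coef2 (f + g) m n = coef2 f m n + coef2 g m n.
Proof. by []. Qed.

Lemma coef2_exp_small f k m n :
  coef2 f 0 0 = 0 -> (m + n < k)%N -> coef2 (f ^+ k) m n = 0.
Proof.
move=> f0; elim: k m n => // k IHk m n mnk; rewrite exprS coef2M.
apply: big1 => i _; apply: big1 => j _.
have [ij0|ij_gt0] := posnP (i + j).
  by move/eqP: ij0; rewrite addn_eq0 => /andP[/eqP-> /eqP->]; rewrite f0 mul0r.
rewrite IHk ?mulr0 //.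
have := ltn_ord i; have := ltn_ord j; rewrite !ltnS => jn im.
by rewrite -(ltn_add2l (i + j)) addnACA !subnKC // (leq_trans mnk) // -add1n leq_add2r.
Qed.

(* In particular the denominators 1 - x^(a+1) y^l are invertible, so that the
   ring inverse is the expected one. *)
Lemma fps2_unit1B f : coef2 f 0 0 = 0 -> 1 - f \is a GRing.unit.
Proof.
move=> f0.
pose G N : fps2 R := \sum_(k < N) f ^+ k.
have GS N m n : (m + n < N)%N -> coef2 (G N) m n = coef2 (G (m + n).+1) m n.
  elim: N => // N IHN; rewrite ltnS leq_eqVlt => /orP[/eqP-> //|mnN].
  by rewrite {1}/G big_ord_recr coef2D coef2_exp_small ?addr0 ?IHN.
apply/unitrPr; exists (Fps2 (fun m n => coef2 (G (m + n).+1) m n)).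
apply: fps2P => m n; rewrite mulrC.
have GE : coef2 (G (m + n).+1 * (1 - f)) m n = coef2 1 m n.
  rewrite mulrC -opprB mulNr -subrX1 opprB -[in RHS](subrK (f ^+ (m + n).+1) 1).
  by rewrite [RHS]coef2D (coef2_exp_small f0) // addr0.
rewrite -GE !coef2M; apply: eq_bigr => i _; apply: eq_bigr => j _ /=.
congr (_ * _).
by rewrite [RHS]GS // ltnS leq_add // -ltnS.
Qed.

End Ring.

Arguments fps2X {R}.
Arguments fps2Y {R}.

Local Open Scope nat_scope.
Local Open Scope classical_set_scope.

Definition is_partition (la : seq nat) : Prop := sorted geq la /\ 0 \notin la.

(* Partitions are kept as sequences of parts; la_(i+1) is [nth 0 la i]. *)
Definition partitions (d : nat) : set (seq nat) :=
  [set la | is_partition la /\ sumn la = d].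

Definition young (la : seq nat) : set (nat * nat) :=
  [set b | b.2 < nth 0 la b.1].

(* [#|` fset_set A |] is the cardinality of the set A when A is finite, as are
   the four sets below. *)
Definition arm (la : seq nat) (b : nat * nat) : nat :=
  if b \in young la
  then #|` fset_set [set c | [/\ young la c, c.1 = b.1 & b.2 < c.2]] |
  else #|` fset_set [set c | [/\ ~ young la c, c.1 = b.1 & c.2 < b.2]] |.

Definition leg (la : seq nat) (b : nat * nat) : nat :=
  if b \in young la
  then #|` fset_set [set c | [/\ young la c, c.2 = b.2 & b.1 < c.1]] |
  else #|` fset_set [set c | [/\ ~ young la c, c.2 = b.2 & c.1 < b.1]] |.

Definition hook (la : seq nat) (b : nat * nat) : nat := arm la b + leg la b + 1.

Definition internal_hooks (d l : nat) : set (seq nat * (nat * nat)) :=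
  [set p | [/\ partitions d p.1, young p.1 p.2 & hook p.1 p.2 = l]].

Definition external_hooks (d l : nat) : set (seq nat * (nat * nat)) :=
  [set p | [/\ partitions d p.1, ~ young p.1 p.2 & hook p.1 p.2 = l]].

(* Both sets are finite, so that products over them taken with fsbigop's
   [\big[op/idx]_(p \in A)] are genuine. *)
Lemma finite_partitions d : finite_set (partitions d).
Proof.
pose f (u : {n : 'I_d.+1 & n.-tuple 'I_d.+1}) : seq nat :=
  [seq val k | k <- tagged u].
apply: (@sub_finite_set _ _ (f @` setT)); last exact/finite_image/finite_finset.
move=> la [[_ la0] lad].
have le_la k : k \in la -> k < d.+1.
  by rewrite -lad ltnS => /perm_to_rem/perm_sumn-> /=; exact: leq_addr.
have sz : size la < d.+1.
  rewrite ltnS -lad; elim: la la0 {lad le_la} => //= k la IH.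
  rewrite inE negb_or eq_sym -lt0n => /andP[k0 /IH le].
  by rewrite -add1n leq_add.
pose t : (size la).-tuple 'I_d.+1 := [tuple of map inord (in_tuple la)].
exists (existT (fun n : 'I_d.+1 => n.-tuple 'I_d.+1) (Ordinal sz) t) => //.
rewrite /f /= -map_comp; apply: map_id_in => k kla /=.
by rewrite inordK ?le_la.
Qed.

Lemma nth_partition d la i : partitions d la -> nth 0 la i <= d.
Proof.
move=> [_ <-]; elim: la i => [|k la IH] [|i] //=; first exact: leq_addr.
exact: leq_trans (IH i) (leq_addl _ _).
Qed.

Lemma nth_partition0 d la i : partitions d la -> d <= i -> nth 0 la i = 0.
Proof.
move=> [[_ la0] <-] h; apply: nth_default; apply: leq_trans h.
elim: la la0 => //= k la IH.
rewrite inE negb_or eq_sym -lt0n => /andP[k0 /IH le].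
by rewrite -add1n leq_add.
Qed.

Lemma finite_internal_hooks d l : finite_set (internal_hooks d l).
Proof.
apply: (@sub_finite_set _ _ (partitions d `*` (`I_d `*` `I_d))).
  move=> [la [i j]] [/= lad yb _]; split => //; split => /=.
    by rewrite ltnNge; apply/negP => /(nth_partition0 lad) e; rewrite /young /= e in yb.
  exact: leq_trans yb (nth_partition _ lad).
by apply: finite_setX; [exact: finite_partitions|apply: finite_setX; exact: finite_II].
Qed.

Lemma card_fset_set_ge (T : choiceType) (A : set T) (s : seq T) :
  finite_set A -> uniq s -> (forall x, x \in s -> A x) ->
  size s <= #|` fset_set A |.
Proof.
move=> Afin us sA; apply: uniq_leq_size => // x xs.
by rewrite in_fset_set // inE; exact: sA.
Qed.

Lemma finite_external_hooks d l : finite_set (external_hooks d l).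
Proof.
apply: (@sub_finite_set _ _ (partitions d `*` (`I_(d + l) `*` `I_(d + l)))); last first.
  by apply: finite_setX; [exact: finite_partitions|apply: finite_setX; exact: finite_II].
move=> [la [i j]] [/= lad nyb hb].
have ny : ((i, j) \in young la) = false by apply/negbTE; rewrite notin_setE.
have fin (B : set (nat * nat)) : B `<=` `I_i.+1 `*` `I_j.+1 -> finite_set B.
  by move=> sB; apply: sub_finite_set sB _; apply: finite_setX; exact: finite_II.
have lea : j - d <= arm la (i, j).
  rewrite /arm ny -[X in X <= _](size_iota d) -(size_map (pair i)).
  apply: card_fset_set_ge.
  - by apply: fin => -[a b] [/= _ -> bj]; split => //=; exact: ltnW.
  - by rewrite map_inj_uniq ?iota_uniq // => ? ? [].
  - move=> _ /mapP[k + ->]; rewrite mem_iota => /andP[dk kj].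
    split => //=; last by move: kj; lia.
    by apply/negP; rewrite /= -leqNgt (leq_trans (nth_partition _ lad)).
have lel : i - d <= leg la (i, j).
  rewrite /leg ny -[X in X <= _](size_iota d) -(size_map (fun k => (k, j))).
  apply: card_fset_set_ge.
  - by apply: fin => -[a b] [/= _ -> bi]; split => //=; exact: ltnW.
  - by rewrite map_inj_uniq ?iota_uniq // => ? ? [].
  - move=> _ /mapP[k + ->]; rewrite mem_iota => /andP[dk ki].
    split => //=; last by move: ki; lia.
    by rewrite /young /= (nth_partition0 lad).
by move: hb lea lel; rewrite /hook => hb lea lel; split => //; split => /=; lia.
Qed.

(* Main.v *)
Require Import Defs.
From mathcomp Require Import all_boot all_order all_algebra.
From mathcomp Require Import finmap zify.
From mathcomp Require Import boolp classical_sets functions cardinality fsbigop.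

(** The two products have the same factors: adding a rim hook is a bijection
    from the external hooks of length [l] of the partitions of [d - l] to the
    internal hooks of length [l] of the partitions of [d], and it preserves
    both the arm and the leg.

    Read the boundary of a Young diagram as a word of unit steps: a vertical
    step for each row, a horizontal step for each column.  A box is a pair
    (row, column), hence a pair of a vertical and a horizontal step, and it
    lies inside or outside the diagram according to which of the two comes
    first.  Its arm and leg count the horizontal and the vertical steps
    strictly between the two.  Exchanging the two steps leaves everything
    between them in place, so it turns an external hook into an internal hook
    with the same arm and leg, and back; on diagrams it adds or removes a rim
    hook with as many boxes as the hook length.

    In terms of row lengths, let (i, j) be outside the partition mu and let s
    be the height of column j, that is, the first row of length at most j.
    The exchange inserts a row of length j + 1 at position s and deletes row i;
    the rows s, ..., i - 1 thus move down by one and gain one box each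
    ([add_rows]).  The new internal box is (s, mu_i).  Conversely, for (i, j)
    inside la and e the last row that meets column j, the rows i + 1, ..., e
    move up by one and lose one box each, row e becomes j, and the new external
    box is (e, la_i - 1) ([remove_rows]).

    All verifications rest on [ltn_col], the Galois connection between row
    lengths and column heights, and on the resulting formulas for arms and
    legs as differences ([arm_in], [arm_out], [leg_in], [leg_out]). *)

Set Implicit Arguments.
Unset Strict Implicit.
Unset Printing Implicit Defensive.

Implicit Types (la mu : seq nat) (i j k n d l : nat).

(** * Rows and columns of a partition *)

Definition row la i := nth 0 la i.
Definition col la j := count (ltn j) la.

Lemma ltn_col la i j : sorted geq la -> (i < col la j) = (j < row la i).
Proof.
rewrite /col /row; elim: la i => [|x la IH] i /=; first by rewrite nth_nil.
move=> xla; have [jx|xj] := ltnP j x.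
  by case: i => [|i] //=; rewrite add1n ltnS IH ?(path_sorted xla).
have /allP lex : all (geq x) la by apply: order_path_min xla => ? ? ? /=; lia.
have -> : count (ltn j) la = 0.
  by apply/eqP; rewrite -leqn0 leqNgt -has_count; apply/hasP => -[y /lex /=]; lia.
case: i => [|i] /=; first by lia.
have [isz|isz] := ltnP i (size la); last by rewrite nth_default.
by have := lex _ (mem_nth 0 isz); rewrite /=; lia.
Qed.

(** Computes the height of a column from its description by rows, which is how
    the columns of diagrams given by their rows are found below. *)
Lemma col_uniq la j n :
  sorted geq la -> (forall k, (k < n) = (j < row la k)) -> col la j = n.
Proof.
move=> sla E; have := ltn_col n j sla; have := ltn_col (col la j) j sla.
by rewrite -!E; lia.
Qed.

Lemma row_antitone la i k : sorted geq la -> i <= k -> row la k <= row la i.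
Proof.
move=> sla ik; have := ltn_col i (row la i) sla; have := ltn_col k (row la i) sla.
by lia.
Qed.

Lemma row_ge_size la i : size la <= i -> row la i = 0.
Proof. exact: nth_default. Qed.

Lemma partition_row_gt0 la i : is_partition la -> (0 < row la i) = (i < size la).
Proof.
move=> [_ la0]; have [isz|/row_ge_size -> //] := ltnP i (size la).
by rewrite lt0n; apply: contraNneq la0 => <-; exact: mem_nth.
Qed.

Lemma eq_partition la mu :
  is_partition la -> is_partition mu -> row la =1 row mu -> la = mu.
Proof.
move=> pla pmu E; apply: (@eq_from_nth _ 0) => [|i _]; last exact: E.
have := partition_row_gt0 (size la) pla; have := partition_row_gt0 (size mu) pla.
have := partition_row_gt0 (size la) pmu; have := partition_row_gt0 (size mu) pmu.
by rewrite !E; lia.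
Qed.

Lemma sumn_row la n : size la <= n -> sumn la = \sum_(k < n) row la k.
Proof.
move=> szn; rewrite sumnE (big_nth 0) big_mkord.
rewrite (big_ord_widen n (fun i => nth 0 la i) szn) big_mkcond /=.
by apply: eq_bigr => k _; case: ltnP => // /row_ge_size.
Qed.

(** Filtering out the zeros makes a partition out of any nonincreasing function
    that vanishes at [n], where [n] is any bound on the number of its rows. *)
Definition of_rows (f : nat -> nat) n := [seq x <- mkseq f n | 0 < x].

(** In a nonincreasing sequence the zeros form a suffix, and reading past the
    end gives zero anyway. *)
Lemma row_filter_gt0 s : sorted geq s -> row [seq x <- s | 0 < x] =1 row s.
Proof.
elim: s => [|x s IH] //= xs k; have [x0|] := posnP x; last first.
  by case: k => [|k] // _; apply: IH; apply: path_sorted xs.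
have /allP lex : all (geq x) s by apply: order_path_min xs => ? ? ? /=; lia.
have row0 i : row s i = 0.
  have [/(mem_nth 0)/lex /=|/row_ge_size -> //] := ltnP i (size s).
  by rewrite x0 leqn0 => /eqP.
rewrite IH ?(path_sorted xs) // row0 x0.
by case: k => [|k] //; rewrite [RHS]row0.
Qed.

Section OfRows.
Variables (f : nat -> nat) (n : nat).
Hypotheses (fS : forall k, f k.+1 <= f k) (fn : f n = 0).

Lemma sorted_rows : sorted geq (mkseq f n).
Proof.
apply/(sortedP 0) => i; rewrite size_mkseq => iS /=.
by rewrite !nth_mkseq ?fS // ltnW.
Qed.

Lemma is_partition_of_rows : is_partition (of_rows f n).
Proof.
split; last by rewrite mem_filter.
by apply: sorted_filter sorted_rows => ? ? ? /=; lia.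
Qed.

Lemma row_of_rows : row (of_rows f n) =1 f.
Proof.
move=> k; rewrite row_filter_gt0 ?sorted_rows //.
have [kn|nk] := ltnP k n; first by rewrite /row nth_mkseq.
rewrite row_ge_size ?size_mkseq //; apply/esym.
elim: k nk => [|k IH] nk; first by rewrite -[RHS]fn; congr f; lia.
have [<- //|nk'] := eqVneq n k.+1.
by have := fS k; have := IH; lia.
Qed.

End OfRows.

(** * Arms and legs as differences *)

Lemma card_fset_set_seq (T : choiceType) (A : set T) (s : seq T) :
  uniq s -> (forall x, A x <-> x \in s) -> #|` fset_set A | = size s.
Proof.
move=> us As; have -> : A = [set` [fset x in s]%fset]%classic.
  by apply/seteqP; split=> x /=; rewrite inE; apply As.
by rewrite set_fsetK card_fseq undup_id.
Qed.

Lemma card_row_segment (A : set (nat * nat)) i m n :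
  (forall b, A b <-> b.1 = i /\ m <= b.2 < n) -> #|` fset_set A | = n - m.
Proof.
move=> As; rewrite (@card_fset_set_seq _ A (map (pair i) (iota m (n - m)))).
- by rewrite size_map size_iota.
- by rewrite map_inj_uniq ?iota_uniq // => ? ? [].
move=> [a b]; rewrite As /=; split=> [[-> h]|/mapP[k + [-> ->]]].
  by apply: map_f; rewrite mem_iota; lia.
by rewrite mem_iota; lia.
Qed.

Lemma card_col_segment (A : set (nat * nat)) j m n :
  (forall b, A b <-> b.2 = j /\ m <= b.1 < n) -> #|` fset_set A | = n - m.
Proof.
move=> As; rewrite (@card_fset_set_seq _ A [seq (k, j) | k <- iota m (n - m)]).
- by rewrite size_map size_iota.
- by rewrite map_inj_uniq ?iota_uniq // => ? ? [].
move=> [a b]; rewrite As /=; split=> [[-> h]|/mapP[k + [-> ->]]].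
  by apply: (map_f (fun k => (k, j))); rewrite mem_iota; lia.
by rewrite mem_iota; lia.
Qed.

Lemma youngE la i j : young la (i, j) = (j < row la i).
Proof. by []. Qed.

Lemma not_young la i j : ~ young la (i, j) <-> row la i <= j.
Proof. by rewrite leqNgt; apply: (rwP negP). Qed.

Lemma in_young la i j : ((i, j) \in young la) = (j < row la i).
Proof. by apply/idP/idP; rewrite inE. Qed.

Lemma arm_in la i j : j < row la i -> arm la (i, j) = row la i - j.+1.
Proof.
move=> ji; rewrite /arm in_young ji; apply: (@card_row_segment _ i) => -[a b].
split=> /= [[+ ai jb]|[-> /andP[jb bi]]]; last by split.
by rewrite youngE ai => ib; split=> //; apply/andP.
Qed.

Lemma arm_out la i j : row la i <= j -> arm la (i, j) = j - row la i.
Proof.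
move=> ij; rewrite /arm in_young ltnNge ij.
apply: (@card_row_segment _ i) => -[a b].
split=> /= [[+ ai bj]|[-> /andP[ib bj]]].
  by rewrite youngE ai => /negP; rewrite -leqNgt => ib; split=> //; apply/andP.
by split=> //; rewrite youngE; apply/negP; rewrite -leqNgt.
Qed.

Lemma leg_in la i j :
  sorted geq la -> j < row la i -> leg la (i, j) = col la j - i.+1.
Proof.
move=> sla ji; rewrite /leg in_young ji.
apply: (@card_col_segment _ j) => -[a b]; rewrite ltn_col //=.
split=> /= [[+ bj ia]|[-> /andP[ia aj]]]; last by split.
by rewrite youngE bj => aj; split=> //; apply/andP.
Qed.

Lemma leg_out la i j :
  sorted geq la -> row la i <= j -> leg la (i, j) = i - col la j.
Proof.
move=> sla ij; rewrite /leg in_young ltnNge ij.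
apply: (@card_col_segment _ j) => -[a b]; rewrite leqNgt ltn_col //=.
split=> /= [[+ bj ai]|[-> /andP[/negP ja ai]]]; last by split.
by rewrite youngE bj => /negP aj; split=> //; apply/andP.
Qed.

(** * Exchanging two boundary steps *)

(** The row lengths after exchanging the steps of row [i] and column [j], for
    (i, j) outside and [s] the height of column [j]. *)
Definition add_rows (f : nat -> nat) s i j k :=
  if k == s then j.+1 else if s < k <= i then (f k.-1).+1 else f k.

(** The same exchange for (i, j) inside, where [e] is the last row that meets
    column [j]. *)
Definition remove_rows (f : nat -> nat) i e j k :=
  if i <= k < e then (f k.+1).-1 else if k == e then j else f k.

(** Rows [s] to [i] of the new diagram are a row of length j + 1 and the old
    rows [s] to [i - 1] with one more box each, while row [i] has gone: the sum
    grows by (j + 1 - f i) + (i - s), which is the hook length of (i, j). *)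
Lemma sum_add_rows f s i j n : s <= i < n -> f i <= j ->
  \sum_(k < n) add_rows f s i j k = \sum_(k < n) f k + (j - f i + (i - s) + 1).
Proof.
move=> /andP[si lin] fij.
have below m : m <= s -> \sum_(k < m) add_rows f s i j k = \sum_(k < m) f k.
  by move=> ms; apply: eq_bigr => k _; rewrite /add_rows !ifF //; have := ltn_ord k; lia.
(* Up to row m the new diagram lags one row behind the old one. *)
have shifted m : s <= m <= i ->
    \sum_(k < m.+1) add_rows f s i j k = \sum_(k < m) f k + j.+1 + (m - s).
  elim: m => [|m IH] h; rewrite big_ord_recr /=.
    by rewrite !big_ord0 /add_rows ifT; lia.
  have [sm|sm] := eqVneq m.+1 s.
    by rewrite below ?sm // /add_rows eqxx subnn addn0.
  rewrite IH; last by lia.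
  by rewrite /add_rows (negbTE sm) ifT /= ?big_ord_recr /=; lia.
elim: n lin => // n IH; rewrite ltnS leq_eqVlt => /predU1P[<-|lin].
  by rewrite shifted ?si ?leqnn // big_ord_recr /=; lia.
rewrite big_ord_recr /= IH // big_ord_recr /= /add_rows !ifF; lia.
Qed.

(** Row [i] may lie beyond the parts of [mu], and the rim hook then adds rows up
    to [i]; hence the bound on the number of rows. *)
Definition add_hook (p : seq nat * (nat * nat)) :=
  let: (mu, (i, j)) := p in
  (of_rows (add_rows (row mu) (col mu j) i j) (size mu + i.+1),
   (col mu j, row mu i)).

Definition remove_hook (p : seq nat * (nat * nat)) :=
  let: (la, (i, j)) := p in
  let e := (col la j).-1 in
  (of_rows (remove_rows (row la) i e j) (size la), (e, (row la i).-1)).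

(** * Adding a rim hook *)

Section AddHook.
Variables (mu : seq nat) (i j : nat).
Hypotheses (pmu : is_partition mu) (out : row mu i <= j).

Let smu : sorted geq mu. Proof. by case: pmu. Qed.
Let s := col mu j.
Let la := (add_hook (mu, (i, j))).1.

Let sP k : (k < s) = (j < row mu k). Proof. exact: ltn_col. Qed.
Let si : s <= i. Proof. by have := sP i; lia. Qed.

Let add_rowsS k : add_rows (row mu) s i j k.+1 <= add_rows (row mu) s i j k.
Proof.
have rowS m : row mu m.+1 <= row mu m by exact: row_antitone.
rewrite /add_rows; have := sP k; have := sP k.+1; have := rowS k; have := rowS k.-1.
by case: k => [|k] /=; do ?case: ifP => ?; lia.
Qed.

Let add_rows_size : add_rows (row mu) s i j (size mu + i.+1) = 0.
Proof. by rewrite /add_rows !ifF ?row_ge_size; have := si; lia. Qed.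

Lemma is_partition_add_hook : is_partition la.
Proof. exact: is_partition_of_rows. Qed.

Lemma row_add_hook : row la =1 add_rows (row mu) s i j.
Proof. exact: row_of_rows. Qed.

Lemma young_add_hook : row mu i < row la s.
Proof. by rewrite row_add_hook /add_rows eqxx. Qed.

(** With [row_add_hook] this shows that in [la] the exchanged steps are those of
    row [s] and of column [row mu i], in the opposite order and bounding the
    same interval; the equality of arms and legs is then immediate. *)
Lemma col_add_hook : col la (row mu i) = i.+1.
Proof.
apply: col_uniq => [|k]; first by case: is_partition_add_hook.
rewrite row_add_hook /add_rows; have := sP k; have := si.
have := @row_antitone mu i k smu; have := @row_antitone mu k.-1 i smu.
by do ?case: ifP => ?; lia.
Qed.

Lemma arm_add_hook : arm la (s, row mu i) = arm mu (i, j).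
Proof.
rewrite arm_in ?young_add_hook // arm_out // row_add_hook /add_rows eqxx.
by rewrite subSS.
Qed.

Lemma leg_add_hook : leg la (s, row mu i) = leg mu (i, j).
Proof.
rewrite leg_in ?young_add_hook ?col_add_hook ?leg_out ?subSS //.
by case: is_partition_add_hook.
Qed.

Lemma sumn_add_hook : sumn la = sumn mu + hook mu (i, j).
Proof.
rewrite /hook arm_out // leg_out // -/s.
rewrite (@sumn_row _ (size la + size mu + i.+1)); last by lia.
rewrite (@sumn_row mu (size la + size mu + i.+1)); last by lia.
under eq_bigr do rewrite row_add_hook.
by rewrite sum_add_rows //; have := si; lia.
Qed.

End AddHook.

(** * Removing a rim hook *)

Section RemoveHook.
Variables (la : seq nat) (i j : nat).
Hypotheses (pla : is_partition la) (inside : j < row la i).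

Let sla : sorted geq la. Proof. by case: pla. Qed.
Let e := (col la j).-1.
Let c := (row la i).-1.
Let mu := (remove_hook (la, (i, j))).1.

Let eP k : (k <= e) = (j < row la k).
Proof. by have := ltn_col k j sla; have := ltn_col i j sla; rewrite /e; lia. Qed.
Let ie : i <= e. Proof. by rewrite eP. Qed.

Let remove_rowsS k :
  remove_rows (row la) i e j k.+1 <= remove_rows (row la) i e j k.
Proof.
have rowS m : row la m.+1 <= row la m by exact: row_antitone.
rewrite /remove_rows; have := eP k; have := eP k.+1; have := eP k.+2.
by have := rowS k; have := rowS k.+1; have := ie; do ?case: ifP => ?; lia.
Qed.

Let remove_rows_size : remove_rows (row la) i e j (size la) = 0.
Proof.
have := eP (size la); have := @row_ge_size la (size la) (leqnn _).
by rewrite /remove_rows; do ?case: ifP => ?; lia.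
Qed.

Lemma is_partition_remove_hook : is_partition mu.
Proof. exact: is_partition_of_rows. Qed.

Lemma row_remove_hook : row mu =1 remove_rows (row la) i e j.
Proof. exact: row_of_rows. Qed.

Lemma outside_remove_hook : row mu e <= c.
Proof.
by rewrite row_remove_hook /remove_rows eqxx ltnn andbF /c; move: inside; lia.
Qed.

Lemma col_remove_hook : col mu c = i.
Proof.
apply: col_uniq => [|k]; first by case: is_partition_remove_hook.
rewrite row_remove_hook /remove_rows /c; have := ie; have := eP k.
have := @row_antitone la i k sla; have := @row_antitone la k i sla.
have := @row_antitone la i k.+1 sla; move: inside.
by do ?case: ifP => ?; lia.
Qed.

End RemoveHook.

(** * The two exchanges are inverse to each other *)

Lemma add_hookK mu i j : is_partition mu -> row mu i <= j ->
  remove_hook (add_hook (mu, (i, j))) = (mu, (i, j)).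
Proof.
move=> pmu out; have pla := is_partition_add_hook pmu out.
have yla := young_add_hook pmu out; have cla := col_add_hook pmu out.
have prem := is_partition_remove_hook pla yla.
have rrem := row_remove_hook pla yla.
have rla := row_add_hook pmu out.
have sP k : (k < col mu j) = (j < row mu k) by apply: ltn_col; case: pmu.
rewrite [LHS]surjective_pairing; congr (_, _); last first.
  by rewrite /= cla rla /add_rows eqxx.
apply: eq_partition => // k; rewrite rrem cla /remove_rows !rla /add_rows !succnK.
have [->|ki] := eqVneq k i; have := sP i; do ?case: ifP => ?; lia.
Qed.

Lemma remove_hookK la i j : is_partition la -> j < row la i ->
  add_hook (remove_hook (la, (i, j))) = (la, (i, j)).
Proof.
move=> pla inside; have pmu := is_partition_remove_hook pla inside.
have ymu := outside_remove_hook pla inside; have cmu := col_remove_hook pla inside.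
have padd := is_partition_add_hook pmu ymu.
have radd := row_add_hook pmu ymu.
have rmu := row_remove_hook pla inside.
rewrite [LHS]surjective_pairing; congr (_, _); last first.
  by rewrite /= cmu rmu /remove_rows eqxx ltnn andbF.
apply: eq_partition => // k; rewrite radd cmu /add_rows !rmu /remove_rows.
have kP : (k < col la j) = (j < row la k) by apply: ltn_col; case: pla.
have iP : (i < col la j) = (j < row la i) by apply: ltn_col; case: pla.
have [->|ki] := eqVneq k i; first by rewrite prednK //; apply: leq_trans inside.
by case: k ki kP => [|k] ki kP; rewrite ?succnK; do ?case: ifP => ?; lia.
Qed.

(** That removal lowers the size by exactly [l] follows from [remove_hookK] and
    the size count for the addition of a rim hook. *)
Lemma add_hook_bij d l :
  set_bij (external_hooks d l) (internal_hooks (d + l) l) add_hook.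
Proof.
split.
- move=> [mu [i j]] [[pmu mud] /not_young out /= hookl]; split.
  + by split; [exact: is_partition_add_hook | rewrite sumn_add_hook // hookl mud].
  + exact: young_add_hook.
  + by rewrite -hookl /hook arm_add_hook ?leg_add_hook.
- move=> [mu [i j]] [nu [i' j']]; rewrite !inE.
  move=> [[pmu _] /not_young out _] [[pnu _] /not_young out' _] E.
  by rewrite -(add_hookK pmu out) E add_hookK.
- move=> [la [i j]] [[pla lad] inside hookl].
  have K := remove_hookK pla inside; exists (remove_hook (la, (i, j))) => //.
  have pmu := is_partition_remove_hook pla inside.
  have out := outside_remove_hook pla inside.
  set mu := (remove_hook (la, (i, j))).1 in pmu out.
  have la_mu : (add_hook (mu, ((col la j).-1, (row la i).-1))).1 = la.
    exact: (congr1 fst K).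
  have box_mu : (col mu (row la i).-1, row mu (col la j).-1) = (i, j).
    exact: (congr1 snd K).
  have hookmu : hook mu ((col la j).-1, (row la i).-1) = l.
    rewrite -hookl /hook -(arm_add_hook pmu out) -(leg_add_hook pmu out).
    by rewrite la_mu box_mu.
  have mud : sumn mu = d.
    by apply: (@addIn l); rewrite -hookmu -sumn_add_hook // la_mu hookmu lad.
  by split=> //; apply/not_young.
Qed.

Local Open Scope ring_scope.

Theorem corollary1p5 (d l : nat) (l_gt0 : (0 < l)%N) (le_ld : (l <= d)%N) :
  \big[*%R/(1 : fps2 int)]_(p \in internal_hooks d l)
      (1 - fps2X ^+ (arm p.1 p.2 + 1) * fps2Y ^+ leg p.1 p.2)^-1
  = \big[*%R/(1 : fps2 int)]_(p \in external_hooks (d - l) l)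
      (1 - fps2X ^+ (arm p.1 p.2 + 1) * fps2Y ^+ leg p.1 p.2)^-1.
Proof.
have := add_hook_bij (d - l) l; rewrite subnK // => bij.
rewrite (@reindex_fsbig _ _ _ _ _ _ _ _ _ bij).
apply: eq_fsbigr => -[mu [i j]]; rewrite inE => -[[pmu _] /not_young out _] /=.
by rewrite arm_add_hook ?leg_add_hook.
Qed.
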